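(* Let $n\ge1$, let $E$ be a Polish space, let $X=(X_1,\dots,X_n)$ be a vector of independent $E$-valued random variables, and let $X'=(X'_1,\dots,X'_n)$ be an independent copy of $X$. Let $f:E^n\to\mathbb{R}$ be measurable with $\mathbf{E}[f(X)^2]<\infty$. Then $$ f(X)=\mathbf{E}[f(X)]+\sum_{k=1}^n\ \sum_{1\le i_1<\cdots<i_k\le n}(-1)^k\,\mathbf{E}\left[\Delta_{i_1}\cdots\Delta_{i_k}f(X',X)\mid X\right]. $$ This formula coincides with the Hoeffding decomposition of $f(X)$: for every $1\le k\le n$ and every $1\le i_1<\dots<i_k\le n$, $$(-1)^k\,\mathbf{E}\left[\Delta_{i_1}\cdots\Delta_{i_k}f(X',X)\mid X\right]=\varphi_{i_1,\dots,i_k}(X_{i_1},\dots,X_{i_k}),$$ where the $\varphi_{i_1,\dots,i_k}$ are the Hoeffding kernels of $f(X)$; consequently $$ \mathbf{E}\Big\{\mathbf{E}\left[\Delta_{i_1}\cdots\Delta_{i_k}f(X',X)\mid X\right]\times\mathbf{E}\left[\Delta_{j_1}\cdots\Delta_{j_l}f(X',X)\mid X\right]\Big\}=0 $$ whenever $\{i_1,\dots,i_k\}\ne\{j_1,\dots,j_l\}$.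
   Context: Equalities between random variables hold almost surely. Difference operators: for $y,y'\in E^n$ and $j\in\{1,\dots,n\}$, $\Delta_jf(y,y')=f(y)-f(y_1,\dots,y_{j-1},y_j',y_{j+1},\dots,y_n)$. For distinct indices $i_1,\dots,i_k$ ($k\ge2$), $\Delta_{i_1}\cdots\Delta_{i_k}f(y,y')$ is defined recursively as $\Delta_{i_1}\cdots\Delta_{i_{k-1}}f(y,y')-(\Delta_{i_1}\cdots\Delta_{i_{k-1}}f(y,y'))_{i_k}$, where $(\cdot)_{i_k}$ means that $y_{i_k}$ is replaced by $y'_{i_k}$ in the argument; this does not depend on the order of the indices. $\Delta_{i_1}\cdots\Delta_{i_k}f(X',X)$ is obtained by taking first argument $X'$ and second argument $X$ (so coordinates of $X'$ are replaced by those of $X$). Hoeffding decomposition: when $\mathbf{E}[f(X)^2]<\infty$, $f(X)$ admits a unique decomposition $$f(X)=\mathbf{E}[f(X)]+\sum_{k=1}^n\sum_{1\le i_1<\cdots<i_k\le n}\varphi_{i_1,\dots,i_k}(X_{i_1},\dots,X_{i_k})$$ with square-integrable kernels satisfying $\mathbf{E}[\varphi_{i_1,\dots,i_k}(X_{i_1},\dots,X_{i_k})\mid X_{j_1},\dots,X_{j_a}]=0$ for every strict subset $\{j_1,\dots,j_a\}$ of $\{i_1,\dots,i_k\}$. *)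

(* Defs.v *)
From mathcomp Require Export all_boot all_order all_algebra.
From mathcomp Require Export all_classical all_reals all_analysis.

Set Implicit Arguments.
Unset Strict Implicit.
Unset Printing Implicit Defensive.

Import Order.TTheory GRing.Theory Num.Theory.
Import numFieldNormedType.Exports.

Local Open Scope classical_set_scope.
Local Open Scope ring_scope.

Definition is_distance (R : realType) (E : Type) (dist : E -> E -> R) : Prop :=
  [/\ forall x y, 0 <= dist x y,
      forall x y, dist x y = 0 <-> x = y,
      forall x y, dist x y = dist y x
    & forall x y z, dist x z <= dist x y + dist y z].

Definition metrizes (R : realType) (E : topologicalType)
    (dist : E -> E -> R) : Prop :=
  forall A : set E,
    open A <->
    forall x, A x -> exists2 e : R, 0 < e & [set y | dist x y < e] `<=` A.

Definition complete_distance (R : realType) (E : Type)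
    (dist : E -> E -> R) : Prop :=
  forall u : nat -> E,
    (forall e : R, 0 < e -> exists N : nat, forall p q : nat,
       (N <= p)%N -> (N <= q)%N -> dist (u p) (u q) < e) ->
    exists l : E, forall e : R, 0 < e -> exists N : nat, forall p : nat,
      (N <= p)%N -> dist (u p) l < e.

Definition polish (R : realType) (E : topologicalType) : Prop :=
  (exists2 D : set E, countable D & dense D) /\
  (exists dist : E -> E -> R,
     [/\ is_distance dist, metrizes dist & complete_distance dist]).

(* E equipped with its Borel sigma-algebra. The product sigma-algebra on
   n.-tuple (borel E) is the library one. *)
Notation borel E := (g_sigma_algebraType (@open E)).

Section Differences.
Context (E : Type) (R : realType) (n : nat).

Definition replace (y y' : n.-tuple E) (i : 'I_n) : n.-tuple E :=
  [tuple if j == i then tnth y' j else tnth y j | j < n].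

(* [Delta f [:: i_1; ...; i_k] y y'] is Delta_{i_1} ... Delta_{i_k} f (y, y');
   the operator with index i_k is the last one applied. *)
Definition Delta (f : n.-tuple E -> R) (s : seq 'I_n) :
    n.-tuple E -> n.-tuple E -> R :=
  foldl (fun (g : n.-tuple E -> n.-tuple E -> R) i =>
           fun y y' => g y y' - g (replace y y' i) y')
        (fun y _ => f y) s.

End Differences.

Definition vect (n : nat) (T E : Type) (X : 'I_n -> T -> E) : T -> n.-tuple E :=
  fun w => [tuple X i w | i < n].

(* (X_{i_1}, ..., X_{i_k}) for I = {i_1 < ... < i_k} (enum_val is increasing
   on ordinals). *)
Definition subvect (n : nat) (T E : Type) (X : 'I_n -> T -> E) (I : {set 'I_n}) :
    T -> #|I|.-tuple E :=
  fun w => [tuple X (enum_val i) w | i < #|I|].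

Section Probability.
Context (d : measure_display) (T : measurableType d) (R : realType).
Variable P : probability T R.

Definition mutually_independent (d' : measure_display) (E : measurableType d')
    (n : nat) (X : 'I_n -> T -> E) : Prop :=
  forall (J : {set 'I_n}) (A : 'I_n -> set E),
    (forall i, i \in J -> measurable (A i)) ->
    P (\bigcap_(i in [set i | i \in J]) (X i @^-1` A i)) =
    (\prod_(i in J) P (X i @^-1` A i))%E.

Definition independent_copy (d' : measure_display) (F : measurableType d')
    (V V' : T -> F) : Prop :=
  (forall A B : set F, measurable A -> measurable B ->
     P (V @^-1` A `&` V' @^-1` B) = (P (V @^-1` A) * P (V' @^-1` B))%E) /\
  (forall A : set F, measurable A -> P (V' @^-1` A) = P (V @^-1` A)).

(* Z is a version of E[Y | V]; the sigma-algebra generated by V is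
   preimage_set_system setT V measurable. *)
Definition is_condexp (d' : measure_display) (F : measurableType d')
    (V : T -> F) (Y Z : T -> R) : Prop :=
  let sigmaV := preimage_set_system [set: T] V measurable in
  [/\ P.-integrable [set: T] (EFin \o Y),
      P.-integrable [set: T] (EFin \o Z),
      forall B : set R, measurable B -> sigmaV (Z @^-1` B)
    & forall A : set T, sigmaV A ->
        (\int[P]_(w in A) (Z w)%:E = \int[P]_(w in A) (Y w)%:E)%E].

(* The kernel of index I = {i_1 < ... < i_k}, k >= 1, is a function of k
   variables; the value of phi at the empty set is irrelevant. *)
Definition hoeffding_kernels (d' : measure_display) (E : measurableType d')
    (n : nat) (X : 'I_n -> T -> E) (f : n.-tuple E -> R)
    (phi : forall I : {set 'I_n}, #|I|.-tuple E -> R) : Prop :=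
  [/\ forall I : {set 'I_n}, I != finset.set0 ->
        measurable_fun [set: #|I|.-tuple E] (@phi I),
      forall I : {set 'I_n}, I != finset.set0 ->
        ('E_P[fun w => (phi I (subvect X I w) ^+ 2)%R] < +oo)%E,
      forall I J : {set 'I_n}, J \proper I ->
        is_condexp (subvect X J) (fun w => phi I (subvect X I w)) (cst 0)
    & {ae P, forall w, f (vect X w) =
        fine ('E_P[f \o vect X])%E +
        \sum_(1 <= k < n.+1) \sum_(I : {set 'I_n} | #|I| == k)
          phi I (subvect X I w)}].

End Probability.

(* Main.v *)
Require Import Defs.
From mathcomp Require Import all_boot all_order all_algebra.
From mathcomp Require Import all_classical all_reals all_analysis.
From mathcomp Require Import measurable_realfun ring lra.
Import Order.TTheory GRing.Theory Num.Theory.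
Import numFieldNormedType.Exports.
Local Open Scope classical_set_scope.
Local Open Scope ring_scope.

(* Let [mix J x y] be [x] on [J] and [y] off [J], and let
   g_J (x) = E[f (mix J x X)]. Expanding the differences and freezing X,
   (-1)^|I| E[Delta_I f (X', X) | X] = sum_(J <= I) (-1)^(|I| - |J|) g_J (X),
   and Moebius inversion over the subsets gives the decomposition, since g_J is
   f for J full and E[f (X)] for J empty. Everything else comes from one
   invariance: exchanging coordinates between X and X' preserves the law of
   (X, X'). Exchanging the i-th ones for some i in I but not in J makes the sum
   above cancel in pairs under E[. | X_J]; exchanging them in a product of a
   kernel of index I and a function not involving the i-th coordinate gives
   orthogonality of the kernels, hence their uniqueness. *)

Set Implicit Arguments.
Unset Strict Implicit.

(** * Sums over subsets *)

Section SubsetSums.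
Context {R : comPzRingType} {I : finType}.
Implicit Types A B C : {set I}.

(** Each subset [B] of [A] avoiding [i] is paired with [i |: B]. The cancellations by sign below and
    the recursion for the difference operators all use this pairing. *)
Lemma sum_subsetsD1 {V : zmodType} A (i : I) (F : {set I} -> V) : i \in A ->
  \sum_(B : {set I} | B \subset A) F B =
  \sum_(B : {set I} | B \subset A :\ i) (F B + F (i |: B)).
Proof.
move=> iA; rewrite big_split/= (bigID (fun B => i \notin B))/=; congr (_ + _).
  by apply: eq_bigl => B; rewrite subsetD1.
rewrite (reindex_onto (fun B => i |: B) (fun B => B :\ i))/=; last first.
  by move=> B /andP[_]; rewrite negbK => iB; rewrite finset.setD1K.
apply: eq_bigl => B; rewrite finset.setU11/= andbT subsetD1.
rewrite finset.subUset finset.sub1set iA/=.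
case: (boolP (i \in B)) => iB; last by rewrite setU1K// eqxx.
rewrite andbF; apply/andP => -[_ /eqP/setP/(_ i)].
by rewrite !inE eqxx iB.
Qed.

(** Complementation turns the supersets of [A] into the subsets of [~: A], which contains some [i];
    adding [i] to a subset flips the sign. *)
Lemma sum_superset_sign A : A != finset.setT ->
  \sum_(B : {set I} | A \subset B) (-1) ^+ (#|B| + #|A|) = 0 :> R.
Proof.
rewrite -finset.subTset => /subsetPn[i _ iA].
rewrite (reindex_inj (inv_inj (@finset.setCK I)))/=.
under eq_bigl do rewrite finset.subsetC.
rewrite (@sum_subsetsD1 _ _ i) ?inE// big1// => B; rewrite subsetD1 => /andP[_ iB].
have -> : #|~: B| = #|~: (i |: B)|.+1.
  by rewrite (cardsD1 i (~: B)) inE iB finset.setCU finset.setIC -finset.setDE.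
by rewrite addSn exprS mulN1r addNr.
Qed.

(** After exchanging the sums, the coefficient of [g A] is the signed count of the supersets of [A],
    which vanishes unless [A] is full. *)
Lemma moebius_subsets (g : {set I} -> R) :
  \sum_(B : {set I}) \sum_(A : {set I} | A \subset B) (-1) ^+ (#|B| + #|A|) * g A =
  g finset.setT.
Proof.
rewrite (exchange_big_dep predT)//=.
under eq_bigr do rewrite -mulr_suml.
rewrite (bigD1 finset.setT)//= [X in _ + X]big1 ?addr0; last first.
  by move=> A AT; rewrite sum_superset_sign// mul0r.
rewrite (big_pred1 [set: I]%SET); last by move=> B; rewrite finset.subTset.
by rewrite exprD -expr2 sqrr_sign mul1r.
Qed.

(** Starting at [k = 1] drops exactly the empty set, and no cardinal exceeds [n]. *)
Lemma sum_setN0_card {V : zmodType} (F : {set I} -> V) (n : nat) : #|I| = n ->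
  \sum_(1 <= k < n.+1) \sum_(B : {set I} | #|B| == k) F B =
  \sum_(B : {set I} | B != finset.set0) F B.
Proof.
move=> <-; rewrite big_nat_cond.
rewrite (exchange_big_dep (fun B => B != finset.set0))/=; last first.
  by move=> k B /andP[/andP[k0 _] _] /eqP Bk; rewrite -card_gt0 Bk.
apply: eq_bigr => B B0.
under eq_bigl do rewrite andbT eq_sym.
by rewrite big_nat1_cond_eq card_gt0 B0 ltnS max_card.
Qed.

End SubsetSums.

(** * Conditional expectation and square integrability *)

Section ConditionalExpectation.
Context {d : measure_display} {T : measurableType d} {R : realType}.
Variable P : probability T R.
Context {d' : measure_display} {F : measurableType d'} {V : T -> F}.
Hypothesis mV : measurable_fun [set: T] V.
Implicit Types Y Z : T -> R.

Let sigmaV : set (set T) := preimage_set_system [set: T] V measurable.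

Lemma sigmaV_measurable A : sigmaV A -> measurable A.
Proof. by move=> [B mB <-]; exact: mV. Qed.

(** Viewing [T] with the sigma-algebra generated by [V] gives the measurability clause of
    [is_condexp] the usual closure properties of measurable functions. *)
Lemma sigmaV_funP Z : (forall B : set R, measurable B -> sigmaV (Z @^-1` B)) <->
  measurable_fun [set: g_sigma_algebra_preimageType V] Z.
Proof.
split=> mZ; first by move=> _ B mB; rewrite setTI; exact: mZ.
by move=> B mB; have := mZ measurableT B mB; rewrite setTI.
Qed.

Lemma is_condexp_comp Y (z : F -> R) : measurable_fun [set: F] z ->
  P.-integrable [set: T] (EFin \o Y) ->
  P.-integrable [set: T] (EFin \o (z \o V)) ->
  (forall B, measurable B -> (\int[P]_(w in V @^-1` B) (z (V w))%:E =
     \int[P]_(w in V @^-1` B) (Y w)%:E)%E) ->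
  is_condexp P V Y (z \o V).
Proof.
move=> mz iY iz zY; split=> // [B mB|_ [B mB <-]]; last by rewrite setTI zY.
exists (z @^-1` B); last by rewrite setTI comp_preimage.
by rewrite -(setTI (z @^-1` B)); exact: mz.
Qed.

Lemma is_condexp0 : is_condexp P V (cst 0) (cst 0).
Proof.
apply: (is_condexp_comp (z := cst 0)) => //; exact: integrable0.
Qed.

Lemma is_condexpZD (a : R) Y1 Z1 Y2 Z2 :
  is_condexp P V Y1 Z1 -> is_condexp P V Y2 Z2 ->
  is_condexp P V (fun w => a * Y1 w + Y2 w) (fun w => a * Z1 w + Z2 w).
Proof.
have ilin Y Y' A : measurable A ->
    P.-integrable [set: T] (EFin \o Y) -> P.-integrable [set: T] (EFin \o Y') ->
    P.-integrable A (EFin \o (fun w => a * Y w + Y' w)) /\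
    (\int[P]_(w in A) (a * Y w + Y' w)%:E =
     a%:E * \int[P]_(w in A) (Y w)%:E + \int[P]_(w in A) (Y' w)%:E)%E.
  move=> mA iY iY'.
  have {}iY := integrableS measurableT mA (@subsetT _ A) iY.
  have {}iY' := integrableS measurableT mA (@subsetT _ A) iY'.
  split.
    have := integrableD mA (integrableZl mA a iY) iY'.
    by apply: eq_integrable => // w _ /=; rewrite EFinD EFinM.
  under eq_integral do rewrite EFinD EFinM.
  rewrite integralD//; last exact: integrableZl.
  by rewrite integralZl.
move=> [iY1 iZ1 mZ1 e1] [iY2 iZ2 mZ2 e2]; split.
- by have [] := ilin _ _ _ measurableT iY1 iY2.
- by have [] := ilin _ _ _ measurableT iZ1 iZ2.
- apply/sigmaV_funP; apply: measurable_funD; last exact/sigmaV_funP.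
  by apply: measurable_funM => //; exact/sigmaV_funP.
- move=> A sA; have mA := sigmaV_measurable sA.
  rewrite (ilin _ _ _ mA iY1 iY2).2 (ilin _ _ _ mA iZ1 iZ2).2.
  by rewrite e1// e2.
Qed.

Lemma is_condexp_sum (I : finType) (Q : pred I) (a : I -> R)
    (Y Z : I -> T -> R) : (forall i, Q i -> is_condexp P V (Y i) (Z i)) ->
  is_condexp P V (fun w => \sum_(i | Q i) a i * Y i w)
    (fun w => \sum_(i | Q i) a i * Z i w).
Proof.
have consE i s (U : I -> T -> R) :
    (fun w => \sum_(j <- i :: s | Q j) a j * U j w) =
    (fun w => if Q i then a i * U i w + \sum_(j <- s | Q j) a j * U j w
              else \sum_(j <- s | Q j) a j * U j w).
  by apply/funext => w; rewrite big_cons.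
have nilE (U : I -> T -> R) : (fun w => \sum_(j <- [::] | Q j) a j * U j w) = cst 0.
  by apply/funext => w; rewrite big_nil.
move=> YZ; elim: (index_enum I) => [|i s ih].
  by rewrite (nilE Y) (nilE Z); exact: is_condexp0.
rewrite (consE i s Y) (consE i s Z); case: (boolP (Q i)) => Qi //.
by apply: is_condexpZD => //; exact: YZ.
Qed.

(** The event [N] where [Z2 < Z1] is generated by [V], so [Z1] and [Z2] both integrate over it like
    [Y]. The positive function [Z1 - Z2] thus has integral zero on [N], which must be null;
    exchanging the roles gives equality. *)
Lemma is_condexp_unique Y Z Z' : is_condexp P V Y Z -> is_condexp P V Y Z' ->
  {ae P, forall w, Z w = Z' w}.
Proof.
suff le Z1 Z2 : is_condexp P V Y Z1 -> is_condexp P V Y Z2 ->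
    {ae P, forall w, Z1 w <= Z2 w}.
  move=> cZ cZ'; have := le _ _ cZ cZ'; have := le _ _ cZ' cZ.
  by apply: filterS2 => w ? ?; apply/eqP; rewrite eq_le; apply/andP.
move=> [iY iZ1 /sigmaV_funP mZ1 e1] [_ iZ2 /sigmaV_funP mZ2 e2].
pose N := [set w | (Z2 w)%:E < (Z1 w)%:E]%E.
have sN : sigmaV N.
  have mZ1' := iffRL (measurable_EFinP _ _) mZ1.
  have mZ2' := iffRL (measurable_EFinP _ _) mZ2.
  by have := measurable_lte measurableT mZ2' mZ1'; rewrite setTI.
have mN := sigmaV_measurable sN.
have iS U : P.-integrable [set: T] (EFin \o U) -> P.-integrable N (EFin \o U).
  exact: integrableS.
have iB : P.-integrable N (fun w => (Z1 w)%:E - (Z2 w)%:E)%E.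
  by apply: integrableB => //; exact: iS.
have : (\int[P]_(w in N) `|(Z1 w)%:E - (Z2 w)%:E| = 0)%E.
  under eq_integral => w.
    rewrite inE => Nw; rewrite gee0_abs ?subre_ge0//; last exact: ltW.
    over.
  rewrite integralB//; [|exact: iS..].
  by rewrite e1// e2// subee//; apply: integrable_fin_num => //; exact: iS.
move/(ae_eq_integral_abs _ mN) => /(_ (measurable_int _ iB)).
apply: filterS => w /= h; rewrite leNgt; apply/negP => Nw.
by have /eqP := h Nw; rewrite -EFinB eqe subr_eq0 => /eqP e; rewrite e ltxx in Nw.
Qed.

Lemma is_condexp_integral Y Z : is_condexp P V Y Z ->
  (\int[P]_w (Z w)%:E = \int[P]_w (Y w)%:E)%E.
Proof. by move=> [_ _ _]; apply; exists setT => //; rewrite setTI. Qed.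

End ConditionalExpectation.

(** * Square-integrable random variables *)

Section SquareIntegrable.
Context {d : measure_display} {T : measurableType d} {R : realType}.
Variable P : probability T R.
Implicit Types Y Z : T -> R.

Definition square_integrable Y := measurable_fun [set: T] Y /\
  P.-integrable [set: T] (EFin \o (fun w => Y w ^+ 2)).

Lemma square_integrableP Y : measurable_fun [set: T] Y ->
  square_integrable Y <-> ('E_P[fun w => (Y w ^+ 2)%R] < +oo)%E.
Proof.
move=> mY; rewrite unlock; split=> [[_ /integrableP[_ +]]|Yoo]; last split=> //.
  apply: le_lt_trans; apply: ge0_le_integral => //.
  - by move=> w _; rewrite lee_fin sqr_ge0.
  - by apply/measurable_EFinP; exact: measurable_funX.
  - by apply: measurableT_comp => //; apply/measurable_EFinP; exact: measurable_funX.
  - by move=> w _; rewrite /= ger0_norm// sqr_ge0.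
apply/integrableP; split; first by apply/measurable_EFinP; exact: measurable_funX.
rewrite (le_lt_trans _ Yoo)//; under eq_integral.
  by move=> w _; rewrite /= ger0_norm ?sqr_ge0//; over.
by [].
Qed.

(** Domination by [Y ^+ 2 + Z ^+ 2]. *)
Lemma square_integrableM Y Z : square_integrable Y -> square_integrable Z ->
  P.-integrable [set: T] (EFin \o (fun w => Y w * Z w)).
Proof.
move=> [mY iY] [mZ iZ]; have := integrableD measurableT iY iZ.
apply: le_integrable => //; first by apply/measurable_EFinP; exact: measurable_funM.
move=> w _; rewrite /= lee_fin [leRHS]ger0_norm ?addr_ge0 ?sqr_ge0//.
rewrite normrM -(real_normK (num_real (Y w))) -(real_normK (num_real (Z w))).
have := sqr_ge0 (`|Y w| - `|Z w|); have := normr_ge0 (Y w); have := normr_ge0 (Z w).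
by nra.
Qed.

Lemma square_integrable_cst a : square_integrable (cst a).
Proof.
split; first exact: measurable_cst.
exact: (finite_measure_integrable_cst P (a ^+ 2) measurableT).
Qed.

Lemma square_integrable_integrable Y : square_integrable Y ->
  P.-integrable [set: T] (EFin \o Y).
Proof.
move=> sY; have := square_integrableM sY (square_integrable_cst 1).
by apply: eq_integrable => // w _ /=; rewrite mulr1.
Qed.

(** Domination of the square by [2 * a ^+ 2 * Y ^+ 2 + 2 * Z ^+ 2]. *)
Lemma square_integrableZD a Y Z : square_integrable Y -> square_integrable Z ->
  square_integrable (fun w => a * Y w + Z w).
Proof.
move=> [mY iY] [mZ iZ].
have mS : measurable_fun [set: T] (fun w => a * Y w + Z w).
  by apply: measurable_funD => //; exact: measurable_funM.
split=> //.
have := integrableD measurableT (integrableZl measurableT (2 * a ^+ 2) iY)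
  (integrableZl measurableT 2 iZ).
apply: le_integrable => //; first by apply/measurable_EFinP; exact: measurable_funX.
move=> w _; rewrite /= lee_fin.
rewrite ger0_norm ?sqr_ge0// ger0_norm; last first.
  by have := sqr_ge0 (Y w); have := sqr_ge0 (Z w); have := sqr_ge0 a; nra.
by have := sqr_ge0 (a * Y w - Z w); nra.
Qed.

Lemma square_integrable_sum (I : finType) (Q : pred I) (a : I -> R)
    (Y : I -> T -> R) : (forall i, Q i -> square_integrable (Y i)) ->
  square_integrable (fun w => \sum_(i | Q i) a i * Y i w).
Proof.
move=> sY; elim: (index_enum I) => [|i s ih].
  rewrite (_ : (fun w => _) = cst 0); last by apply/funext => w; rewrite big_nil.
  exact: square_integrable_cst.
rewrite (_ : (fun w => _) =
    (fun w => if Q i then a i * Y i w + \sum_(j <- s | Q j) a j * Y j w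
              else \sum_(j <- s | Q j) a j * Y j w)); last first.
  by apply/funext => w; rewrite big_cons.
by case: (boolP (Q i)) => Qi //; apply: square_integrableZD => //; exact: sY.
Qed.

(* Jensen, from 2 c Y - c^2 <= Y^2 with c the mean of Y. *)
Lemma sqr_mean_le Y : measurable_fun [set: T] Y ->
  (((fine (\int[P]_w (Y w)%:E)) ^+ 2)%R%:E <= \int[P]_w (Y w ^+ 2)%R%:E)%E.
Proof.
(* An infinite second moment makes the bound trivial, whatever value [fine] takes; otherwise [Y] is
   integrable and [c] is its true mean. *)
move=> mY; have [|Yoo] := leP +oo%E (\int[P]_w (Y w ^+ 2)%R%:E)%E.
  by apply: le_trans; rewrite leey.
have sY : square_integrable Y by apply/square_integrableP => //; rewrite unlock.
have iY := square_integrable_integrable sY.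
set c := fine _.
have ic : (\int[P]_w (Y w)%:E = c%:E)%E by rewrite fineK// integrable_fin_num.
have iC : P.-integrable [set: T] (EFin \o cst (- c ^+ 2)).
  exact: (finite_measure_integrable_cst P (- c ^+ 2) measurableT).
have iL := integrableD measurableT (integrableZl measurableT (2 * c) iY) iC.
have := le_integral measurableT iL sY.2.
rewrite /= integralD//; last exact: integrableZl.
have icst : (\int[P]_w (- c ^+ 2)%:E = (- c ^+ 2)%:E)%E.
  by have := expectation_cst P (- c ^+ 2); rewrite unlock.
rewrite integralZl// [X in (_ * X + _)%E]ic icst.
rewrite -EFinM -EFinD (_ : 2 * c * c + - c ^+ 2 = c ^+ 2); last by ring.
apply=> w _; rewrite /= lee_fin.
by have := sqr_ge0 (Y w - c); nra.
Qed.

Lemma integral_mul_indic (A : set T) Y :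
  (\int[P]_(w in A) (Y w)%:E = \int[P]_w (Y w * \1_A w)%:E)%E.
Proof.
rewrite integral_mkcond; apply: eq_integral => w _; rewrite patchE indicE.
by case: (w \in A); rewrite ?mulr1 ?mulr0.
Qed.

Lemma integrable_mul_indic (A : set T) Y : measurable A ->
  P.-integrable [set: T] (EFin \o Y) ->
  P.-integrable [set: T] (EFin \o (fun w => Y w * \1_A w)).
Proof.
move=> mA iY; apply: le_integrable (iY) => //.
  apply/measurable_EFinP; apply: measurable_funM => //.
  by apply/measurable_EFinP; exact: measurable_int iY.
move=> w _; rewrite /= lee_fin indicE.
by case: (_ \in _); rewrite ?mulr1 ?mulr0// normr0.
Qed.

End SquareIntegrable.

(** * Exchanging coordinates with an independent copy *)

Section SameLaw.
Context {d : measure_display} {T : measurableType d} {R : realType}.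
Variable P : probability T R.
Context {d' : measure_display} {F : measurableType d'}.
Implicit Types U V : T -> F.

Definition same_law U V := forall A : set F, measurable A ->
  P (U @^-1` A) = P (V @^-1` A).

(** Both integrals of [|h|] are integrals against image measures, and these agree on measurable
    sets. *)
Lemma same_law_integrable U V (h : F -> \bar R) :
  measurable_fun [set: T] U -> measurable_fun [set: T] V -> same_law U V ->
  measurable_fun [set: F] h ->
  P.-integrable [set: T] (h \o U) -> P.-integrable [set: T] (h \o V).
Proof.
move=> mU mV UV mh /integrableP[_ iU]; apply/integrableP; split.
  exact: measurableT_comp.
rewrite (le_lt_trans _ iU)//.
have mah : measurable_fun [set: F] (abse \o h) by exact: measurableT_comp.
have := ge0_integral_pushforward mU P measurableT mah (fun _ _ => abse_ge0 _).
have := ge0_integral_pushforward mV P measurableT mah (fun _ _ => abse_ge0 _).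
rewrite !preimage_setT => <- <-.
pose U' : {mfun T >-> F} := mfun_Sub (mem_set mU).
pose V' : {mfun T >-> F} := mfun_Sub (mem_set mV).
rewrite (@eq_measure_integral _ _ _ _ (distribution P V') (distribution P U'))//.
by move=> A mA _; rewrite /= /distribution /pushforward /= UV.
Qed.

Lemma same_law_integral U V (h : F -> \bar R) :
  measurable_fun [set: T] U -> measurable_fun [set: T] V -> same_law U V ->
  measurable_fun [set: F] h -> P.-integrable [set: T] (h \o U) ->
  (\int[P]_w h (U w) = \int[P]_w h (V w))%E.
Proof.
move=> mU mV UV mh iU; have iV := same_law_integrable mU mV UV mh iU.
have := integral_pushforward mU mh (D := setT) iU measurableT.
have := integral_pushforward mV mh (D := setT) iV measurableT.
rewrite !preimage_setT => <- <-.
pose U' : {mfun T >-> F} := mfun_Sub (mem_set mU).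
pose V' : {mfun T >-> F} := mfun_Sub (mem_set mV).
rewrite (@eq_measure_integral _ _ _ _ (distribution P V') (distribution P U'))//.
by move=> A mA _; rewrite /= /distribution /pushforward /= UV.
Qed.

Lemma same_lawC U V : same_law U V -> same_law V U.
Proof. by move=> UV A /UV. Qed.

End SameLaw.

(** * Mixing the coordinates of two tuples *)

Section Mix.
Context {E : Type} {n : nat}.
Implicit Types (J K : {set 'I_n}) (x y z : n.-tuple E).

Definition mix J x y : n.-tuple E :=
  [tuple if j \in J then tnth x j else tnth y j | j < n].

Lemma tnth_mix J x y j :
  tnth (mix J x y) j = if j \in J then tnth x j else tnth y j.
Proof. by rewrite tnth_mktuple. Qed.

Lemma mixT x y : mix [set: 'I_n]%SET x y = x.
Proof. by apply: eq_from_tnth => j; rewrite tnth_mix inE. Qed.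

Lemma mix0 x y : mix finset.set0 x y = y.
Proof. by apply: eq_from_tnth => j; rewrite tnth_mix inE. Qed.

End Mix.

Section MixMeasurable.
Context {d d' : measure_display} {T : measurableType d} {S : measurableType d'}.
Variable n : nat.

Lemma measurable_mix (J : {set 'I_n}) (u v : T -> n.-tuple S) :
  measurable_fun [set: T] u -> measurable_fun [set: T] v ->
  measurable_fun [set: T] (fun w => mix J (u w) (v w)).
Proof.
move=> mu mv; apply/measurable_fun_tnthP => j.
rewrite [X in measurable_fun _ X](_ : _ = if j \in J then (@tnth _ S ^~ j) \o u
    else (@tnth _ S ^~ j) \o v); last first.
  by apply/funext => w /=; rewrite tnth_mix; case: ifP.
by case: ifP => _; apply: measurableT_comp => //; exact: measurable_tnth.
Qed.

Definition box (A : 'I_n -> set S) : set (n.-tuple S) :=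
  [set x | forall i, A i (tnth x i)].

Lemma measurable_box (A : 'I_n -> set S) : (forall i, measurable (A i)) ->
  measurable (box A).
Proof.
move=> mA; rewrite (_ : box A = \bigcap_(i in [set: 'I_n])
    ((@tnth _ S ^~ i) @^-1` A i)); last first.
  by apply/seteqP; split=> x xA i; [move=> _; exact: xA|exact: (xA i)].
apply: fin_bigcap_measurable => // i _.
by rewrite -[X in measurable X]setTI; exact: measurable_tnth.
Qed.

(** Products of boxes form a class stable under intersection; that they generate the product
    sigma-algebra lets two laws of pairs be compared on them alone. *)
Lemma measurable_pair_box :
  @measurable _ (n.-tuple S * n.-tuple S)%type =
  <<s [set C | exists A, exists B, [/\ forall i, measurable (A i),
      forall i, measurable (B i) & C = box A `*` box B] ] >>.
Proof.
set G := [set C | _].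
pose H := g_sigma_algebraType G.
apply/seteqP; split.
- have boxT : box (fun _ => setT) = setT by apply/seteqP; split.
  (* A cylinder over one coordinate is a box whose other sides are full, so every coordinate of
     either tuple is measurable for the generated sigma-algebra. *)
  have box1 (i : 'I_n) (C : set S) :
      box (fun j => if j == i then C else setT) = (@tnth _ S ^~ i) @^-1` C.
    apply/seteqP; split=> [x /(_ i)|x Cx j /=]; first by rewrite eqxx.
    by case: eqP => [->|].
  have mid : measurable_fun [set: H] (fun x : H => (x : n.-tuple S * n.-tuple S)).
    have -> : (fun x : H => (x : n.-tuple S * n.-tuple S)) =
        (fun x => (x.1, x.2)) by apply/funext => -[].
    apply: measurable_fun_pair; apply/measurable_fun_tnthP => i _ C mC;
      rewrite setTI; apply: sub_sigma_algebra.
    + exists (fun j => if j == i then C else setT), (fun _ => setT).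
      split=> // [j|]; first by case: ifP.
      by rewrite boxT box1; apply/seteqP; split=> [x|x []].
    + exists (fun _ => setT), (fun j => if j == i then C else setT).
      split=> // [j|]; first by case: ifP.
      by rewrite boxT box1; apply/seteqP; split=> [x|x []].
  by move=> C mC; have := mid measurableT C mC; rewrite setTI.
- apply: smallest_sub; first exact: sigma_algebra_measurable.
  by move=> _ [A [B [mA mB ->]]]; apply: measurableX; exact: measurable_box.
Qed.

End MixMeasurable.

(** * Exchange invariance, and averaging over an independent copy *)

Section IndependentCopy.
Context {d d' : measure_display} {T : measurableType d} {S : measurableType d'}.
Context {R : realType} {P : probability T R} {n : nat}.
Variables X X' : 'I_n -> {RV P >-> S}.
Hypothesis hX : mutually_independent P X.
Hypothesis hX' : independent_copy P (vect X) (vect X').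

Notation F := (n.-tuple S).
Implicit Types (J K : {set 'I_n}).

Lemma measurable_vect (Y : 'I_n -> {RV P >-> S}) : measurable_fun [set: T] (vect Y).
Proof.
apply/measurable_fun_tnthP => j.
rewrite (_ : _ \o _ = Y j) ?measurable_funP//.
by apply/funext => w /=; rewrite tnth_mktuple.
Qed.

Let mX := measurable_vect X.
Let mX' := measurable_vect X'.

Definition coupled : T -> F * F := fun w => (vect X w, vect X' w).

Lemma measurable_coupled : measurable_fun [set: T] coupled.
Proof. exact: measurable_fun_pair. Qed.

(** The exchange takes place off [J]: with [~: [set i]], only the [i]-th coordinates are
    exchanged. *)
Definition swapped J : T -> F * F := fun w =>
  (mix J (vect X w) (vect X' w), mix J (vect X' w) (vect X w)).

Lemma measurable_swapped J : measurable_fun [set: T] (swapped J).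
Proof. by apply: measurable_fun_pair; exact: measurable_mix. Qed.

Lemma vect_box (A : 'I_n -> set S) : (forall i, measurable (A i)) ->
  P (vect X @^-1` box A) = (\prod_i P (X i @^-1` A i))%E.
Proof.
move=> mA; have := hX (J := [set: 'I_n]%SET) (fun i _ => mA i).
rewrite (eq_bigl predT); last by move=> i; rewrite inE.
move=> <-; congr (P _); apply/seteqP; split=> w wA i.
  by move=> _; have := wA i; rewrite tnth_mktuple.
by rewrite tnth_mktuple; apply: wA => /=; rewrite inE.
Qed.

Let pair_box (A B : 'I_n -> set S) :
  (forall i, measurable (A i)) -> (forall i, measurable (B i)) ->
  P (coupled @^-1` (box A `*` box B)) =
  (\prod_i (P (X i @^-1` A i) * P (X i @^-1` B i)))%E.
Proof.
move=> mA mB; rewrite big_split/= -!vect_box//.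
by rewrite (hX'.1 _ _ (measurable_box mA) (measurable_box mB)) hX'.2//;
  exact: measurable_box.
Qed.

(* It suffices to compare both laws on products of boxes, where the exchange
   only permutes the factors of the product of marginals. *)
Lemma same_law_swapped J : same_law P (swapped J) coupled.
Proof.
pose U : {mfun T >-> _} := mfun_Sub (mem_set (measurable_swapped J)).
pose V : {mfun T >-> _} := mfun_Sub (mem_set measurable_coupled).
apply: (measure_unique _ (fun=> setT) (@measurable_pair_box _ S n) _ _ _
  (distribution P U) (distribution P V)) => //.
- move=> _ _ [A [B [mA mB ->]]] [A' [B' [mA' mB' ->]]].
  exists (fun i => A i `&` A' i), (fun i => B i `&` B' i).
  split=> [i|i|]; [exact: measurableI|exact: measurableI|].
  apply/seteqP; split=> [[x y] [[/= xA yB] [/= xA' yB']]|[x y] [/= xA yB]].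
    by split=> i /=.
  by split; split=> i /=; [have [] := xA i|have [] := yB i|have [] := xA i
    |have [] := yB i].
- move=> _; exists (fun=> setT), (fun=> setT); split=> //.
  by apply/seteqP; split.
- by rewrite bigcup_const.
- move=> _ [A [B [mA mB ->]]].
  (* The preimage of a product of boxes under the exchange is the product of boxes whose sides off
     [J] have been exchanged. *)
  pose A1 i := if i \in J then A i else B i.
  pose B1 i := if i \in J then B i else A i.
  change (P (swapped J @^-1` (box A `*` box B)) =
          P (coupled @^-1` (box A `*` box B))).
  rewrite (_ : swapped J @^-1` _ = coupled @^-1` (box A1 `*` box B1)).
    rewrite !pair_box//; last 2 first.
      by move=> i; rewrite /A1; case: ifP.
      by move=> i; rewrite /B1; case: ifP.
    by apply: eq_bigr => i _; rewrite /A1 /B1; case: ifP => _ //; rewrite muleC.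
  apply/seteqP; split=> w /= [wA wB]; split=> i; have := wA i; have := wB i;
    by rewrite !tnth_mix /A1 /B1; case: ifP.
- by move=> k; rewrite (le_lt_trans (probability_le1 _ _))// ltry.
Qed.

Let mu : probability F R := distribution P (mfun_Sub (mem_set mX)).

(* [average H x] is E[H(x, X)]. *)
Definition average (H : F * F -> R) (x : F) : R :=
  fine (\int[mu]_y (H (x, y))%:E)%E.

(** The copy is independent of [X] and has its law [mu], so the pair has law [mu \x mu]; this gives
    access to Fubini and Tonelli. *)
Let law_coupled (C : set (F * F)) : measurable C ->
  (mu \x mu)%E C = P (coupled @^-1` C).
Proof.
pose V : {mfun T >-> _} := mfun_Sub (mem_set measurable_coupled).
move=> mC.
apply: (@product_measure_unique _ _ _ _ _ _ _ (distribution P V)) => // A B mA mB.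
transitivity (P (vect X @^-1` A) * P (vect X' @^-1` B))%E.
  exact: hX'.1.
by rewrite hX'.2.
Qed.

Let pair_integrable (H : F * F -> R) : measurable_fun [set: F * F] H ->
  P.-integrable [set: T] (EFin \o (H \o coupled)) ->
  (mu \x mu)%E.-integrable [set: F * F] (EFin \o H).
Proof.
move=> mH iH; have mEH : measurable_fun [set: F * F] (EFin \o H).
  exact/measurable_EFinP.
have := integrable_pushforward measurable_coupled mEH (D := setT) iH measurableT.
case/integrableP => _ fi; apply/integrableP; split=> //.
rewrite (le_lt_trans _ fi)//.
pose V : {mfun T >-> _} := mfun_Sub (mem_set measurable_coupled).
rewrite (@eq_measure_integral _ _ _ _ (distribution P V))//.
by move=> A mA _; rewrite /= law_coupled.
Qed.

Let pair_integral (H : F * F -> R) : measurable_fun [set: F * F] H ->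
  P.-integrable [set: T] (EFin \o (H \o coupled)) ->
  (\int[(mu \x mu)%E]_z (H z)%:E = \int[P]_w (H (coupled w))%:E)%E.
Proof.
move=> mH iH; have mEH : measurable_fun [set: F * F] (EFin \o H).
  exact/measurable_EFinP.
have := integral_pushforward measurable_coupled mEH (D := setT) iH measurableT.
rewrite preimage_setT => <-.
pose V : {mfun T >-> _} := mfun_Sub (mem_set measurable_coupled).
rewrite (@eq_measure_integral _ _ _ _ (distribution P V))//.
by move=> A mA _; rewrite /= law_coupled.
Qed.

Lemma measurable_average H : measurable_fun [set: F * F] H ->
  P.-integrable [set: T] (EFin \o (H \o coupled)) ->
  measurable_fun [set: F] (average H).
Proof.
move=> mH iH; have := measurable_fubini_F (pair_integrable mH iH).
by apply: measurableT_comp; exact: fine_measurable.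
Qed.

Let average_integral H : measurable_fun [set: F * F] H ->
  P.-integrable [set: T] (EFin \o (H \o coupled)) ->
  P.-integrable [set: T] (EFin \o (average H \o vect X)) /\
  (\int[P]_w (average H (vect X w))%:E = \int[P]_w (H (coupled w))%:E)%E.
Proof.
move=> mH iH; have imH := pair_integrable mH iH.
have mA : measurable_fun [set: F] (EFin \o average H).
  by apply/measurable_EFinP; exact: measurable_average.
have iF := integrable_fubini_F imH.
have iA : mu.-integrable [set: F] (EFin \o average H).
  (* [fine] sends infinite values to 0, so it can only decrease the absolute value of the section
     integral. *)
  apply: le_integrable iF => // x _.
  rewrite /= /average /fubini_F.
  by case: (\int[_]_y _)%E => [r||] //=; rewrite normr0 leey.
have iAX : P.-integrable [set: T] (EFin \o (average H \o vect X)).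
  case/integrableP: iA => _ fi; apply/integrableP; split.
    exact: (measurableT_comp mA mX).
  rewrite (le_lt_trans _ fi)// ge0_integral_distribution//.
  exact: measurableT_comp.
split=> //; rewrite -pair_integral// -(integral12_prod_meas1 imH).
transitivity (\int[mu]_x (average H x)%:E)%E.
  by rewrite integral_distribution.
apply: ae_eq_integral => //; first exact: measurable_int iF.
(* By Fubini almost every section integral is finite, and there [fine] loses nothing. *)
have := integrable_ae measurableT iF.
by apply: filterS => x /(_ I) h _; rewrite /= fineK.
Qed.

(** Freezing [X] and integrating out its independent copy gives the conditional expectation given
    [X]. *)
Lemma average_condexp H : measurable_fun [set: F * F] H ->
  P.-integrable [set: T] (EFin \o (H \o coupled)) ->
  is_condexp P (vect X) (H \o coupled) (average H \o vect X).
Proof.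
move=> mH iH; apply: is_condexp_comp => //.
- exact: measurable_average.
- exact: (average_integral mH iH).1.
move=> B mB; rewrite [LHS]integral_mul_indic [RHS]integral_mul_indic.
pose HB z := H z * \1_B z.1.
have mHB : measurable_fun [set: F * F] HB.
  apply: measurable_funM => //; apply: measurableT_comp => //.
have iHB : P.-integrable [set: T] (EFin \o (HB \o coupled)).
  have mXB : measurable (vect X @^-1` B) by rewrite -[_ @^-1` _]setTI; exact: mX.
  exact: (integrable_mul_indic mXB iH).
have avE x : average HB x = average H x * \1_B x.
  rewrite /average /HB /= indicE; case: (_ \in _).
    by rewrite mulr1; under eq_integral do rewrite mulr1.
  by rewrite mulr0; under eq_integral do rewrite mulr0; rewrite integral0.
rewrite -[RHS](average_integral mHB iHB).2.
by apply: eq_integral => w _; rewrite avE.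
Qed.

(** Jensen on each section [y |-> H (x, y)], followed by Tonelli. *)
Lemma average_square_integrable H : measurable_fun [set: F * F] H ->
  square_integrable P (H \o coupled) ->
  square_integrable P (average H \o vect X).
Proof.
move=> mH sH; have iH := square_integrable_integrable sH.
have mA : measurable_fun [set: F] (average H) by exact: measurable_average.
have mHsec x : measurable_fun [set: F] (fun y => H (x, y)).
  by apply: measurableT_comp => //; exact: pair1_measurable.
have mH2 : measurable_fun [set: F * F] (fun z => (H z ^+ 2)%:E).
  by apply/measurable_EFinP; exact: measurable_funX.
apply/square_integrableP; first exact: measurableT_comp.
have [_] := sH; move/(pair_integrable (measurable_funX 2 mH)) => /integrableP[_].
apply: le_lt_trans; rewrite unlock.
have mA2 : measurable_fun [set: F] (fun x => (average H x ^+ 2)%:E).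
  by apply/measurable_EFinP; exact: measurable_funX.
rewrite -(ge0_integral_distribution (mfun_Sub (mem_set mX)) mA2); last first.
  by move=> x; rewrite lee_fin sqr_ge0.
under [leRHS]eq_integral do rewrite /= ger0_norm ?sqr_ge0//.
rewrite fubini_tonelli1//; last by move=> z; rewrite lee_fin sqr_ge0.
apply: ge0_le_integral => //.
- by move=> x _; rewrite lee_fin sqr_ge0.
- by apply: measurable_fun_fubini_tonelli_F => // z; rewrite lee_fin sqr_ge0.
- by move=> x _; exact: sqr_mean_le.
Qed.

(** The factor [k x] comes out of the integral wherever the section of [H] at [x] is integrable,
    that is, for almost every [x]. *)
Lemma average_mulr H (k : F -> R) : measurable_fun [set: F * F] H ->
  P.-integrable [set: T] (EFin \o (H \o coupled)) ->
  {ae P, forall w, average (fun z => k z.1 * H z) (vect X w) =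
                   k (vect X w) * average H (vect X w)}.
Proof.
move=> mH iH; have [N [mN N0 sN]] := ae_integrable1 (pair_integrable mH iH).
exists (vect X @^-1` N); split=> //; first by rewrite -[_ @^-1` _]setTI; exact: mX.
move=> w /= nw; apply: sN => /= iw; apply: nw.
transitivity (fine (\int[mu]_y ((k (vect X w))%:E * (EFin \o H) (vect X w, y)))%E).
  by [].
by rewrite (integralZl measurableT iw) fineM// integrable_fin_num.
Qed.

Lemma swapped_integral J H : measurable_fun [set: F * F] H ->
  P.-integrable [set: T] (EFin \o (H \o coupled)) ->
  P.-integrable [set: T] (EFin \o (H \o swapped J)) /\
  (\int[P]_w (H (swapped J w))%:E = \int[P]_w (H (coupled w))%:E)%E.
Proof.
move=> mH iH; have sl := same_lawC (same_law_swapped J).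
have mS := measurable_swapped J.
have mEH : measurable_fun [set: F * F] (EFin \o H) by exact/measurable_EFinP.
split; first exact: (same_law_integrable measurable_coupled mS sl mEH).
by rewrite -(same_law_integral measurable_coupled mS sl mEH iH).
Qed.

End IndependentCopy.

(** * Subvectors and difference operators *)

Section Projection.
Context {n : nat}.
Implicit Types I J : {set 'I_n}.

Definition proj {E : Type} I (x : n.-tuple E) : #|I|.-tuple E :=
  [tuple tnth x (enum_val i) | i < #|I|].

Lemma subvectE {T E : Type} (X : 'I_n -> T -> E) I w :
  subvect X I w = proj I (vect X w).
Proof. by apply: eq_from_tnth => i; rewrite !tnth_mktuple. Qed.

(** A right inverse of [proj] on the coordinates in [I], the others being filled with [e]. It turns
    a function of [n] variables that reads only those in [I] into a function of [#|I|] variables. *)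
Definition extend {E : Type} (e : E) I (t : #|I|.-tuple E) : n.-tuple E :=
  [tuple if [pick i : 'I_#|I| | enum_val i == j] is Some i then tnth t i else e
  | j < n].

Lemma tnth_extend_proj {E : Type} (e : E) I (x : n.-tuple E) j : j \in I ->
  tnth (extend e (proj I x)) j = tnth x j.
Proof.
move=> jI; rewrite tnth_mktuple; case: pickP => [i /eqP <-|].
  by rewrite tnth_mktuple.
by move/(_ (enum_rank_in jI j)); rewrite enum_rankK_in// eqxx.
Qed.

(** The filling is invisible, since [mix J] reads its first argument only on [J]. *)
Lemma mix_extend_proj {E : Type} (e : E) I J (x y : n.-tuple E) : J \subset I ->
  mix J (extend e (proj I x)) y = mix J x y.
Proof.
move=> /fintype.subsetP JI; apply: eq_from_tnth => j; rewrite !tnth_mix.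
by case: ifP => // /JI; exact: tnth_extend_proj.
Qed.

Lemma proj_mix {E : Type} I J (x y : n.-tuple E) : I \subset J ->
  proj I (mix J x y) = proj I x.
Proof.
move=> /fintype.subsetP IJ; apply: eq_from_tnth => i.
by rewrite !tnth_mktuple IJ// enum_valP.
Qed.

Context {d : measure_display} {S : measurableType d}.

Lemma measurable_proj I : measurable_fun [set: n.-tuple S] (@proj S I).
Proof.
apply/measurable_fun_tnthP => i.
rewrite (_ : _ \o _ = (@tnth _ S ^~ (enum_val i))); first exact: measurable_tnth.
by apply/funext => x /=; rewrite tnth_mktuple.
Qed.

Lemma measurable_extend (e : S) I :
  measurable_fun [set: #|I|.-tuple S] (@extend S e I).
Proof.
apply/measurable_fun_tnthP => j.
rewrite (_ : _ \o _ = fun t => if [pick i : 'I_#|I| | enum_val i == j] is Some i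
  then tnth t i else e); last by apply/funext => t /=; rewrite tnth_mktuple.
by case: pickP => [i _|_]; [exact: measurable_tnth|exact: measurable_cst].
Qed.

End Projection.

(** [J] is the set of indices at which [y] is replaced by [y'], each replacement costing a sign. As
    the indices are distinct, the last operator splits the sum according to whether its index lies
    in [J]. *)
Lemma Delta_sum {E : Type} {R : realType} {n : nat} (f : n.-tuple E -> R)
    (s : seq 'I_n) (y y' : n.-tuple E) : uniq s ->
  Delta f s y y' =
  \sum_(J : {set 'I_n} | J \subset [set i in s]) (-1) ^+ #|J| * f (mix J y' y).
Proof.
elim/last_ind: s y => [|s i ih] y.
  move=> _; rewrite (big_pred1 finset.set0) ?cards0 ?expr0 ?mul1r ?mix0//.
  by move=> J; rewrite (_ : [set i in [::]] = finset.set0) ?finset.subset0.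
rewrite rcons_uniq => /andP[iNs us].
have iA : i \in [set j in rcons s i] by rewrite inE mem_rcons mem_head.
rewrite (sum_subsetsD1 _ iA).
have -> : [set j in rcons s i] :\ i = [set j in s].
  apply/setP => j; rewrite !inE mem_rcons inE.
  by case: eqP => [->|]//=; rewrite (negbTE iNs).
rewrite /Delta foldl_rcons -!/(Delta _ _ _ _) !ih// big_split/=; congr (_ + _).
rewrite -sumrN; apply: eq_bigr => J /fintype.subsetP JA.
have iJ : i \notin J by apply/negP => /JA; rewrite inE (negbTE iNs).
rewrite cardsU1 iJ exprS mulN1r mulNr; congr (- (_ * f _)).
(* Replacing the [i]-th coordinate and then those in [J] amounts to replacing those in [i |: J]. *)
apply: eq_from_tnth => j; rewrite !tnth_mix tnth_mktuple !inE.
by case: eqP => [->|]//=; rewrite (negbTE iJ).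
Qed.

Lemma measurable_sumr {d : measure_display} {T : measurableType d} {R : realType}
    (I : finType) (Q : pred I) (h : I -> T -> R) :
  (forall i, measurable_fun [set: T] (h i)) ->
  measurable_fun [set: T] (fun x => \sum_(i | Q i) h i x).
Proof.
move=> mh; elim: (index_enum I) => [|i s ih].
  by under eq_fun do rewrite big_nil; exact: measurable_cst.
rewrite (_ : (fun x => _) = fun x => if Q i then h i x + \sum_(j <- s | Q j) h j x
    else \sum_(j <- s | Q j) h j x); last by apply/funext => x; rewrite big_cons.
by case: (Q i) => //; exact: measurable_funD.
Qed.

(** * Hoeffding kernels *)

Section Hoeffding.
Context {d d' : measure_display} {T : measurableType d} {S : measurableType d'}.
Context {R : realType} {P : probability T R} {n : nat}.
Variables X X' : 'I_n -> {RV P >-> S}.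
Hypothesis hX : mutually_independent P X.
Hypothesis hX' : independent_copy P (vect X) (vect X').

Notation F := (n.-tuple S).
Implicit Types (I J K L : {set 'I_n}).

Lemma measurable_subvect (Y : 'I_n -> {RV P >-> S}) J :
  measurable_fun [set: T] (subvect Y J).
Proof.
rewrite (_ : subvect Y J = proj J \o vect Y).
  by apply: measurableT_comp; [exact: measurable_proj|exact: measurable_vect].
by apply/funext => w; rewrite subvectE.
Qed.

Let mX := measurable_vect X.
Let mSub := measurable_subvect X.

Lemma measurable_comp_mix J (h : F -> R) : measurable_fun [set: F] h ->
  measurable_fun [set: F * F] (fun z => h (mix J z.1 z.2)).
Proof.
by move=> mh; apply: measurableT_comp => //; exact: measurable_mix.
Qed.

(** [mix J X X'] is the first component of [swapped J], hence has the law of [X]. *)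
Lemma integrable_comp_mix J (h : F -> R) : measurable_fun [set: F] h ->
  P.-integrable [set: T] (EFin \o (h \o vect X)) ->
  P.-integrable [set: T]
    (EFin \o ((fun z => h (mix J z.1 z.2)) \o coupled X X')).
Proof.
move=> mh ih.
have mH : measurable_fun [set: F * F] (h \o fst) by exact: measurableT_comp.
exact: (swapped_integral hX hX' J mH ih).1.
Qed.

Lemma square_integrable_comp_mix J (h : F -> R) : measurable_fun [set: F] h ->
  square_integrable P (h \o vect X) ->
  square_integrable P ((fun z => h (mix J z.1 z.2)) \o coupled X X').
Proof.
move=> mh [_ sh]; split.
  apply: (measurableT_comp (measurable_comp_mix J mh)).
  exact: measurable_coupled.
exact: (integrable_comp_mix J (measurable_funX 2 mh) sh).
Qed.

(** Identifies g_J (X) with E[h (X) | X_J]. The average factors through X_J, and the exchange off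
    [J], which fixes X_J, replaces [h (mix J X X')] by [h (X)] in the integrals over events
    generated by X_J. *)
Lemma average_mix_condexp J (h : F -> R) : measurable_fun [set: F] h ->
  P.-integrable [set: T] (EFin \o (h \o vect X)) ->
  is_condexp P (subvect X J) (h \o vect X)
    (average X (fun z => h (mix J z.1 z.2)) \o vect X).
Proof.
move=> mh ih; pose H (z : F * F) := h (mix J z.1 z.2).
rewrite -/H.
have mH : measurable_fun [set: F * F] H by exact: measurable_comp_mix.
have iH : P.-integrable [set: T] (EFin \o (H \o coupled X X')).
  exact: integrable_comp_mix.
have [_ iA _ eA] := average_condexp hX' mH iH.
have AE : average X H \o vect X = (average X H \o @extend n S point J) \o subvect X J.
  apply/funext => w; rewrite /= subvectE /average; congr (fine _).
  by apply: eq_integral => y _; rewrite /H /= mix_extend_proj.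
rewrite AE; apply: is_condexp_comp => //.
- apply: measurableT_comp; last exact: measurable_extend.
  exact: measurable_average mH iH.
- by rewrite -AE.
move=> B mB.
have mprojB : measurable (@proj n S J @^-1` B).
  by rewrite -[X in measurable X]setTI; exact: measurable_proj.
have mSB : measurable (subvect X J @^-1` B).
  by rewrite -[X in measurable X]setTI; exact: mSub.
have SBE : subvect X J @^-1` B = vect X @^-1` (proj J @^-1` B).
  by apply/seteqP; split=> w /=; rewrite subvectE.
transitivity (\int[P]_(w in subvect X J @^-1` B) (H (coupled X X' w))%:E)%E.
  rewrite [in RHS]SBE -eA; last by exists (proj J @^-1` B) => //; rewrite setTI.
  by rewrite -SBE; apply: eq_integral => w _; rewrite -[in RHS]/((_ \o _) w) AE.
rewrite [LHS]integral_mul_indic [RHS]integral_mul_indic.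
pose K (z : F * F) := H z * \1_B (proj J z.1).
have mK : measurable_fun [set: F * F] K.
  apply: measurable_funM => //; apply: measurableT_comp => //.
  by apply: measurableT_comp => //; exact: measurable_proj.
have KE : K \o coupled X X' =
    fun w => (H \o coupled X X') w * \1_(subvect X J @^-1` B) w.
  by apply/funext => w; rewrite SBE.
have iK : P.-integrable [set: T] (EFin \o (K \o coupled X X')).
  by rewrite KE; exact: integrable_mul_indic.
transitivity (\int[P]_w (K (coupled X X' w))%:E)%E.
  by apply: eq_integral => w _; rewrite -[in RHS]/((_ \o _) w) KE.
(* Mixing the two exchanged vectors along [J] restores [X]. *)
rewrite -(swapped_integral hX hX' J mK iK).2.
apply: eq_integral => w _; rewrite /K /H /= SBE proj_mix//; congr (_ * _)%:E.
congr h; apply: eq_from_tnth => j; rewrite !tnth_mix.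
by case: (j \in J).
Qed.

(* The mean of [h (X)] given all coordinates but the [i]-th vanishes, and
   exchanging the [i]-th coordinates of [X] and [X'] leaves [k (X)] fixed. *)
Lemma degenerate_orthogonal (I : {set 'I_n}) (i : 'I_n)
    (phi : #|I|.-tuple S -> R) (k : F -> R) : i \in I ->
  measurable_fun [set: #|I|.-tuple S] phi -> measurable_fun [set: F] k ->
  (forall x y, k (mix (~: [set i]) x y) = k x) ->
  square_integrable P (fun w => phi (subvect X I w)) ->
  square_integrable P (k \o vect X) ->
  is_condexp P (subvect X (I :\ i)) (fun w => phi (subvect X I w)) (cst 0) ->
  (\int[P]_w (phi (subvect X I w) * k (vect X w))%:E = 0)%E.
Proof.
move=> iI mphi mk kE sphi sk cphi.
pose h : F -> R := phi \o proj I.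
have hE : (fun w => phi (subvect X I w)) = h \o vect X.
  by apply/funext => w; rewrite subvectE.
have mh : measurable_fun [set: F] h.
  by apply: measurableT_comp => //; exact: measurable_proj.
rewrite hE in sphi cphi.
have ih := square_integrable_integrable sphi.
pose J := ~: [set i]; pose H (z : F * F) := h (mix J z.1 z.2).
have mH : measurable_fun [set: F * F] H by exact: measurable_comp_mix.
have iH : P.-integrable [set: T] (EFin \o (H \o coupled X X')).
  exact: integrable_comp_mix.
(* [~: [set i]] and [I :\ i] have the same trace on [I], the only coordinates read by [h]. The
   average of [H] is therefore the conditional expectation given the coordinates in [I :\ i], which
   is zero. *)
have HE : H = fun z => h (mix (I :\ i) z.1 z.2).
  apply/funext => z; rewrite /H /h /=; congr phi; apply: eq_from_tnth => l.
  by rewrite !tnth_mktuple !inE enum_valP andbT.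
have A0 : {ae P, forall w, average X H (vect X w) = 0}.
  have := is_condexp_unique (@mSub _) (average_mix_condexp (I :\ i) mh ih) cphi.
  by apply: filterS => w /=; rewrite HE.
pose K (z : F * F) := h z.1 * k z.1.
have mK : measurable_fun [set: F * F] K.
  by apply: measurable_funM; exact: measurableT_comp.
have iK : P.-integrable [set: T] (EFin \o (K \o coupled X X')).
  exact: (square_integrableM sphi sk).
have [isK eK] := swapped_integral hX hX' J mK iK.
pose G (z : F * F) := k z.1 * H z.
have GE : G \o coupled X X' = K \o swapped X X' J.
  by apply/funext => w; rewrite /G /K /H /= kE mulrC.
have mG : measurable_fun [set: F * F] G.
  by apply: measurable_funM => //; exact: measurableT_comp.
have iG : P.-integrable [set: T] (EFin \o (G \o coupled X X')) by rewrite GE.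
transitivity (\int[P]_w (K (coupled X X' w))%:E)%E.
  by apply: eq_integral => w _; rewrite subvectE.
(* After the exchange, integrating out the copy leaves [k (X)] times the average of [H], which
   vanishes almost surely by [A0]. *)
rewrite -eK; transitivity (\int[P]_w (average X G (vect X w))%:E)%E.
  have cG := average_condexp hX' mG iG.
  by rewrite (is_condexp_integral cG) GE.
rewrite -(integral0 P setT); apply: ae_eq_integral => //.
  apply/measurable_EFinP; apply: measurableT_comp => //.
  exact: measurable_average mG iG.
have := average_mulr hX' k mH iH; move: A0; apply: filterS2 => w.
by move=> e -> _; rewrite e mulr0.
Qed.

Definition degenerate_kernel I (phi : #|I|.-tuple S -> R) :=
  [/\ measurable_fun [set: #|I|.-tuple S] phi,
      square_integrable P (fun w => phi (subvect X I w))
    & forall J, J \proper I ->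
        is_condexp P (subvect X J) (fun w => phi (subvect X I w)) (cst 0)].

(** Distinct sets are not included in each other both ways, so by symmetry some [i] lies in [I] and
    not in [K]; then [psi] does not involve the [i]-th coordinate. *)
Lemma degenerate_kernel_orthogonal I K (phi : #|I|.-tuple S -> R)
    (psi : #|K|.-tuple S -> R) : I != K ->
  degenerate_kernel phi -> degenerate_kernel psi ->
  (\int[P]_w (phi (subvect X I w) * psi (subvect X K w))%:E = 0)%E.
Proof.
wlog IK : I K phi psi / ~~ (I \subset K).
  move=> H IK dphi dpsi; have [sIK|nIK] := boolP (I \subset K); last exact: H.
  under eq_integral do rewrite mulrC.
  apply: H => //; last by rewrite eq_sym.
  by apply: contra IK => sKI; rewrite finset.eqEsubset sIK.
move=> _ [mphi sphi cphi] [mpsi spsi cpsi].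
have [i iI iK] := subsetPn IK.
have psiE : (fun w => psi (subvect X K w)) = (psi \o proj K) \o vect X.
  by apply/funext => w; rewrite subvectE.
transitivity (\int[P]_w (phi (subvect X I w) * (psi \o proj K) (vect X w))%:E)%E.
  by apply: eq_integral => w _ /=; rewrite -subvectE.
apply: (degenerate_orthogonal (i := i)) => //.
- by apply: measurableT_comp => //; exact: measurable_proj.
- move=> x y /=; rewrite proj_mix//; apply/fintype.subsetP => j jK.
  by rewrite !inE; apply: contraNneq iK => <-.
- by rewrite -psiE.
- by apply: cphi; rewrite finset.properD1.
Qed.

(** The function g_J of the introduction. *)
Definition partial_mean (f : F -> R) J : F -> R :=
  average X (fun z => f (mix J z.1 z.2)).

(** The exponent [#|I| + #|J|] has the parity of [#|I| - #|J|] and avoids subtraction of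
    naturals. *)
Definition hoeffding_term (f : F -> R) I (x : F) : R :=
  \sum_(J : {set 'I_n} | J \subset I) (-1) ^+ (#|I| + #|J|) * partial_mean f J x.

Definition hoeffding_kernel (f : F -> R) I (t : #|I|.-tuple S) : R :=
  hoeffding_term f I (extend point t).

Lemma hoeffding_kernelE f I w :
  hoeffding_kernel f (subvect X I w) = hoeffding_term f I (vect X w).
Proof.
rewrite /hoeffding_kernel subvectE; apply: eq_bigr => J JI; congr (_ * fine _).
by apply: eq_integral => y _ /=; rewrite mix_extend_proj.
Qed.

(** * Existence of the decomposition and its difference formula *)

Section Kernels.
Variable f : F -> R.
Hypothesis mf : measurable_fun [set: F] f.
Hypothesis sf : square_integrable P (f \o vect X).

Let if_ : P.-integrable [set: T] (EFin \o (f \o vect X)).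
Proof. exact: square_integrable_integrable. Qed.

Let mH J := measurable_comp_mix J mf.
Let iH J := integrable_comp_mix J mf if_.

Lemma measurable_partial_mean J : measurable_fun [set: F] (partial_mean f J).
Proof. exact: measurable_average (@mH J) (iH J). Qed.

Lemma partial_mean_square_integrable J :
  square_integrable P (partial_mean f J \o vect X).
Proof.
apply: average_square_integrable; [exact: hX'|exact: mH|].
exact: square_integrable_comp_mix.
Qed.

Lemma partial_mean_condexp J : is_condexp P (vect X)
  (fun w => f (mix J (vect X w) (vect X' w))) (partial_mean f J \o vect X).
Proof. by have := average_condexp hX' (@mH J) (iH J). Qed.

Lemma partial_meanT x : partial_mean f [set: 'I_n]%SET x = f x.
Proof.
rewrite /partial_mean /average /=; under eq_integral do rewrite mixT.
by have := expectation_cst (distribution P (mfun_Sub (mem_set mX))) (f x);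
  rewrite unlock => ->.
Qed.

Lemma partial_mean0 x : partial_mean f finset.set0 x = fine ('E_P[f \o vect X])%E.
Proof.
rewrite /partial_mean /average /= unlock; under eq_integral do rewrite mix0.
congr fine; rewrite integral_distribution//.
exact/measurable_EFinP.
Qed.

(* Exchanging the [i]-th coordinates of [X] and [X'] fixes the coordinates in
   [J] and turns [f (mix L X X')] into [f (mix (i |: L) X X')]. *)
Lemma partial_mean_condexp_setU1 J L i : i \notin J -> i \notin L ->
  is_condexp P (subvect X J)
    (fun w => partial_mean f L (vect X w) - partial_mean f (i |: L) (vect X w))
    (cst 0).
Proof.
move=> iJ iL.
have ig K : P.-integrable [set: T] (EFin \o (partial_mean f K \o vect X)).
  exact/square_integrable_integrable/partial_mean_square_integrable.
apply: (is_condexp_comp (z := cst 0)) => //; last 2 first.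
- exact: integrable0.
- move=> B mB; rewrite integral0.
  set A := subvect X J @^-1` B.
  have mprojB : measurable (@proj n S J @^-1` B).
    by rewrite -[X in measurable X]setTI; exact: measurable_proj.
  have AE : A = vect X @^-1` (proj J @^-1` B).
    by apply/seteqP; split=> w; rewrite /A /= subvectE.
  have mA : measurable A by rewrite -[A]setTI; exact: mSub.
  have igA K : P.-integrable A (EFin \o (partial_mean f K \o vect X)).
    exact: integrableS (ig K).
  (* [A] is also generated by the whole of [X], so the mean over the copy can be undone before
     exchanging coordinates. *)
  have eA K : (\int[P]_(w in A) (partial_mean f K (vect X w))%:E =
      \int[P]_w (f (mix K (vect X w) (vect X' w)) * \1_A w)%:E)%E.
    have [_ _ _ ->] := partial_mean_condexp K; first exact: integral_mul_indic.
    by exists (proj J @^-1` B) => //; rewrite setTI.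
  under eq_integral do rewrite EFinB.
  rewrite integralB//; [|exact: igA..].
  suff -> : (\int[P]_(w in A) (partial_mean f L (vect X w))%:E =
             \int[P]_(w in A) (partial_mean f (i |: L) (vect X w))%:E)%E.
    by rewrite subee//; exact: integrable_fin_num (igA _).
  rewrite !eA.
  pose K (z : F * F) := f (mix L z.1 z.2) * \1_B (proj J z.1).
  have mK : measurable_fun [set: F * F] K.
    apply: measurable_funM => //; apply: measurableT_comp => //.
    by apply: measurableT_comp => //; exact: measurable_proj.
  have KE : K \o coupled X X' =
      fun w => f (mix L (vect X w) (vect X' w)) * \1_A w.
    by apply/funext => w; rewrite AE.
  have iK : P.-integrable [set: T] (EFin \o (K \o coupled X X')).
    rewrite KE; apply: integrable_mul_indic => //; exact: iH.
  transitivity (\int[P]_w (K (coupled X X' w))%:E)%E.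
    by apply: eq_integral => w _; rewrite -[in RHS]/((_ \o _) w) KE.
  rewrite -(swapped_integral hX hX' (~: [set i]) mK iK).2.
  apply: eq_integral => w _; rewrite /K /= AE proj_mix; last first.
    by apply/fintype.subsetP => j jJ; rewrite !inE; apply: contraNneq iJ => <-.
  congr (f _ * _)%:E; apply: eq_from_tnth => j; rewrite !tnth_mix !inE.
  by case: eqP => [->|] /=; rewrite ?(negbTE iL).
- have := integrableB measurableT (ig L) (ig (i |: L)).
  by apply: eq_integrable => // w _ /=; rewrite EFinB.
Qed.

(** For [J] strictly inside [I], choose [i] in [I] but not in [J]. Pairing [L] with [i |: L] turns
    the alternating sum into differences whose conditional expectation given X_J is zero. *)
Lemma hoeffding_kernel_degenerate I : degenerate_kernel (@hoeffding_kernel f I).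
Proof.
have kE : (fun w => @hoeffding_kernel f I (subvect X I w)) =
    fun w => \sum_(J : {set 'I_n} | J \subset I)
      (-1) ^+ (#|I| + #|J|) * (partial_mean f J \o vect X) w.
  by apply/funext => w; rewrite hoeffding_kernelE.
split.
- rewrite /hoeffding_kernel /hoeffding_term.
  apply: (@measurable_comp _ _ _ _ _ _ setT (hoeffding_term f I)) => //.
    apply: measurable_sumr => J; apply: measurable_funM => //.
    exact: measurable_partial_mean.
  exact: measurable_extend.
- rewrite kE; apply: square_integrable_sum => J _.
  exact: partial_mean_square_integrable.
- move=> J JI; have [_ [i iI iJ]] := fintype.properP JI.
  rewrite kE.
  rewrite (_ : (fun w => _) = fun w => \sum_(L : {set 'I_n} | L \subset I :\ i)
     (-1) ^+ (#|I| + #|L|) * (partial_mean f L (vect X w) -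
       partial_mean f (i |: L) (vect X w))); last first.
    apply/funext => w; rewrite (sum_subsetsD1 _ iI).
    apply: eq_bigr => L; rewrite subsetD1 => /andP[_ iL].
    by rewrite cardsU1 iL add1n addnS exprS mulN1r mulNr mulrBr.
  rewrite (_ : cst 0 = fun w : T => \sum_(L : {set 'I_n} | L \subset I :\ i)
     (-1) ^+ (#|I| + #|L|) * (cst 0 : T -> R) w); last first.
    by apply/funext => w; rewrite big1// => L _; rewrite mulr0.
  apply: is_condexp_sum; first exact: mSub.
  move=> L; rewrite subsetD1 => /andP[_ iL].
  exact: partial_mean_condexp_setU1.
Qed.

Lemma hoeffding_kernel_hoeffding_kernels :
  hoeffding_kernels P X f (@hoeffding_kernel f).
Proof.
split.
- by move=> I _; have [] := hoeffding_kernel_degenerate I.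
- move=> I _; have [mk sk _] := hoeffding_kernel_degenerate I.
  by apply/square_integrableP; first exact: (measurableT_comp mk (@mSub I)).
- by move=> I J JI; have [_ _] := hoeffding_kernel_degenerate I; exact.
- apply: aeW => w; rewrite (sum_setN0_card _ (card_ord n)).
  rewrite -[LHS]partial_meanT -(partial_mean0 (vect X w)).
  rewrite -(moebius_subsets (fun J => partial_mean f J (vect X w))).
  (* The term of the empty set in the inversion formula is the mean; the others are the kernels. The
     identity holds at every point. *)
  rewrite [LHS](bigD1 finset.set0)//=; congr (_ + _).
    rewrite (big_pred1 finset.set0); last by move=> J; rewrite finset.subset0.
    by rewrite cards0 mul1r.
  by apply: eq_bigr => I _; rewrite hoeffding_kernelE.
Qed.

(** The differences start from [X'] and insert coordinates of [X], so [J] indexes the coordinates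
    kept under conditioning, and linearity applies. *)
Lemma Delta_condexp I : is_condexp P (vect X)
  (fun w => Delta f (enum I) (vect X' w) (vect X w))
  (fun w => \sum_(J : {set 'I_n} | J \subset I)
     (-1) ^+ #|J| * partial_mean f J (vect X w)).
Proof.
rewrite (_ : (fun w => Delta _ _ _ _) = fun w => \sum_(J : {set 'I_n} | J \subset I)
    (-1) ^+ #|J| * f (mix J (vect X w) (vect X' w))); last first.
  apply/funext => w; rewrite Delta_sum ?enum_uniq//.
  by apply: eq_bigl => J; rewrite (_ : [set i in enum I] = I)// set_enum.
apply: is_condexp_sum; first exact: mX.
by move=> J _; exact: partial_mean_condexp.
Qed.

(** The factor [(-1) ^+ #|I|] is what turns the signs of the expanded differences into those of
    [hoeffding_term]. *)
Lemma Delta_condexp_kernel I Z : is_condexp P (vect X)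
    (fun w => Delta f (enum I) (vect X' w) (vect X w)) Z ->
  {ae P, forall w, (-1) ^+ #|I| * Z w = hoeffding_kernel f (subvect X I w)}.
Proof.
move=> cZ; have := is_condexp_unique mX cZ (Delta_condexp I).
apply: filterS => w /= ->; rewrite hoeffding_kernelE mulr_sumr.
by apply: eq_bigr => J _; rewrite exprD mulrA.
Qed.

End Kernels.

(** * Uniqueness of the kernels *)

Lemma hoeffding_kernels_degenerate f phi I : hoeffding_kernels P X f phi ->
  I != finset.set0 -> degenerate_kernel (phi I).
Proof.
move=> [mphi sphi cphi _] I0; split; [exact: mphi| |exact: cphi].
apply/square_integrableP; last exact: sphi.
exact: (measurableT_comp (mphi I I0) (@mSub I)).
Qed.

Lemma degenerate_kernelB I (phi psi : #|I|.-tuple S -> R) :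
  degenerate_kernel phi -> degenerate_kernel psi ->
  degenerate_kernel (fun t => phi t - psi t).
Proof.
have BE : (fun w => phi (subvect X I w) - psi (subvect X I w)) =
    fun w => -1 * psi (subvect X I w) + phi (subvect X I w).
  by apply/funext => w; rewrite mulN1r addrC.
move=> [mphi sphi cphi] [mpsi spsi cpsi]; split.
- exact: measurable_funB.
- by rewrite BE; exact: square_integrableZD.
- move=> J JI; rewrite BE.
  have := is_condexpZD (@mSub J) (-1) (cpsi J JI) (cphi J JI).
  rewrite (_ : (fun w => -1 * cst 0 w + cst 0 w) = cst 0)//.
  by apply/funext => w; rewrite mulr0 addr0.
Qed.

(* By orthogonality, E[D_I^2] is the inner product of [D I] with the zero sum. *)
Lemma degenerate_kernels_eq0 (D : forall I, #|I|.-tuple S -> R) :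
  (forall I, I != finset.set0 -> degenerate_kernel (D I)) ->
  {ae P, forall w, \sum_(I : {set 'I_n} | I != finset.set0) D I (subvect X I w) = 0} ->
  forall I, I != finset.set0 -> {ae P, forall w, D I (subvect X I w) = 0}.
Proof.
move=> dD D0 I I0.
(* The family is padded with 0 at the empty set, where nothing is known of [D], so that sums run
   over all subsets. *)
pose Y K w : R := if K == finset.set0 then 0 else D K (subvect X K w).
have YE K : K != finset.set0 -> Y K = fun w => D K (subvect X K w).
  by move=> /negPf K0; apply/funext => w; rewrite /Y K0.
have sY K : square_integrable P (Y K).
  have [->|K0] := eqVneq K finset.set0.
    rewrite (_ : Y _ = cst 0); first exact: square_integrable_cst.
    by apply/funext => w; rewrite /Y eqxx.
  by rewrite YE//; have [] := dD K K0.
have orth K : K != I -> (\int[P]_w (Y I w * Y K w)%:E = 0)%E.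
  move=> KI; have [->|K0] := eqVneq K finset.set0.
    by rewrite -(integral0 P setT); apply: eq_integral => w _; rewrite /Y eqxx mulr0.
  rewrite !YE//; apply: degenerate_kernel_orthogonal; [by rewrite eq_sym|exact: dD|exact: dD].
have sumY : (\int[P]_w \sum_(K : {set 'I_n}) (Y I w * Y K w)%:E = 0)%E.
  rewrite -[RHS](integral0 P setT); apply: ae_eq_integral => //.
    under eq_fun do rewrite sumEFin.
    apply/measurable_EFinP; apply: measurable_sumr => K.
    by apply: measurable_funM; [exact: (sY I).1|exact: (sY K).1].
  move: D0; apply: filterS => w D0 _.
  rewrite sumEFin -mulr_sumr (bigD1 finset.set0)//= {2}/Y eqxx add0r.
  rewrite (eq_bigr (fun K => D K (subvect X K w))) ?D0 ?mulr0// => K K0.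
  by rewrite YE.
(* By orthogonality only the diagonal term of the expanded inner product survives. *)
have sq0 : (\int[P]_w (Y I w * Y I w)%:E = 0)%E.
  rewrite -sumY integral_sum//; last first.
    by move=> K; exact: square_integrableM (sY I) (sY K).
  by rewrite (bigD1 I)//= big1 ?adde0.
have mYI : measurable_fun [set: T] (fun w => (Y I w * Y I w)%:E).
  by apply/measurable_EFinP; apply: measurable_funM; exact: (sY I).1.
have : (\int[P]_w `|(Y I w * Y I w)%:E| = 0)%E.
  rewrite -[RHS]sq0; apply: eq_integral => w _.
  by rewrite gee0_abs// lee_fin -expr2 sqr_ge0.
move/(ae_eq_integral_abs _ measurableT mYI); apply: filterS => w /(_ Logic.I) [].
by rewrite YE// => /eqP; rewrite mulf_eq0 orbb => /eqP.
Qed.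

(** The differences of the kernels are degenerate, and they sum to zero almost surely because both
    families represent [f (X)] with the same mean. *)
Lemma hoeffding_kernels_unique f phi psi : hoeffding_kernels P X f phi ->
  hoeffding_kernels P X f psi -> forall I, I != finset.set0 ->
  {ae P, forall w, phi I (subvect X I w) = psi I (subvect X I w)}.
Proof.
move=> hphi hpsi I I0.
have := @degenerate_kernels_eq0 (fun I t => phi I t - psi I t) _ _ I I0.
have h1 : forall I, I != finset.set0 -> degenerate_kernel (fun t => phi I t - psi I t).
  move=> K K0; apply: degenerate_kernelB.
    exact: (hoeffding_kernels_degenerate hphi).
  exact: (hoeffding_kernels_degenerate hpsi).
move=> /(_ h1) h2.
have {}h2 : {ae P, forall w, phi I (subvect X I w) - psi I (subvect X I w) = 0}.
  apply: h2; have [_ _ _] := hphi; have [_ _ _] := hpsi.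
  apply: filterS2 => w e1; rewrite e1 !(sum_setN0_card _ (card_ord n)).
  by move=> /addrI e; rewrite sumrB e subrr.
by move: h2; apply: filterS => w /eqP; rewrite subr_eq0 => /eqP.
Qed.

End Hoeffding.

(** * Transfer to arbitrary versions of the conditional expectations *)

Lemma ae_eq_integrable {d : measure_display} {T : measurableType d} {R : realType}
    (mu : {measure set T -> \bar R}) (g h : T -> \bar R) :
  measurable_fun [set: T] h -> {ae mu, forall x, g x = h x} ->
  mu.-integrable [set: T] g -> mu.-integrable [set: T] h.
Proof.
move=> mh gh /integrableP[mg ig]; apply/integrableP; split=> //.
rewrite -(@ge0_ae_eq_integral _ _ _ mu setT (abse \o g))//.
- exact: measurableT_comp.
- exact: measurableT_comp.
- by move=> x _; exact: abse_ge0.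
- by apply: filterS gh => x /= -> _.
Qed.

Unset Implicit Arguments.

Theorem theorem2p2 (R : realType) (d : measure_display) (T : measurableType d)
    (P : probability T R) (n : nat) (hn : (1 <= n)%N)
    (E : ptopologicalType) (hE : polish R E)
    (X X' : 'I_n -> {RV P >-> borel E})
    (hX : mutually_independent P X)
    (hX' : independent_copy P (vect X) (vect X'))
    (f : n.-tuple (borel E) -> R)
    (hf : measurable_fun [set: n.-tuple (borel E)] f)
    (hf2 : ('E_P[fun w => (f (vect X w) ^+ 2)%R] < +oo)%E) :
  (* the conditional expectations and the Hoeffding kernels exist *)
  (forall I : {set 'I_n}, I != finset.set0 ->
     exists Z : T -> R,
       is_condexp P (vect X)
         (fun w => Delta f (enum I) (vect X' w) (vect X w)) Z) /\
  (exists phi : forall I : {set 'I_n}, #|I|.-tuple (borel E) -> R,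
     hoeffding_kernels P X f phi) /\
  (* Z I is any version of E[Delta_{i_1} ... Delta_{i_k} f(X', X) | X] *)
  (forall Z : {set 'I_n} -> T -> R,
     (forall I : {set 'I_n}, I != finset.set0 ->
        is_condexp P (vect X)
          (fun w => Delta f (enum I) (vect X' w) (vect X w)) (Z I)) ->
     [/\ {ae P, forall w, f (vect X w) =
            fine ('E_P[f \o vect X])%E +
            \sum_(1 <= k < n.+1) \sum_(I : {set 'I_n} | #|I| == k)
              (-1) ^+ k * Z I w},
         forall phi : forall I : {set 'I_n}, #|I|.-tuple (borel E) -> R,
           hoeffding_kernels P X f phi ->
           forall I : {set 'I_n}, I != finset.set0 ->
             {ae P, forall w,
                (-1) ^+ #|I| * Z I w = phi I (subvect X I w)}
       & forall I J : {set 'I_n}, I != finset.set0 -> J != finset.set0 ->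
           I != J ->
           P.-integrable [set: T] (fun w => (Z I w * Z J w)%:E) /\
           ('E_P[fun w => (Z I w * Z J w)%R] = 0)%E]).
Proof.
have mX := measurable_vect X.
have mfX : measurable_fun [set: T] (f \o vect X) by exact: measurableT_comp.
have sf : square_integrable P (f \o vect X) by apply/square_integrableP.
have hk := hoeffding_kernel_hoeffding_kernels hX hX' hf sf.
split; [|split].
- by move=> I _; exists (fun w => \sum_(J : {set 'I_n} | J \subset I)
     (-1) ^+ #|J| * partial_mean X f J (vect X w)); exact: Delta_condexp.
- by exists (@hoeffding_kernel _ _ _ _ _ _ _ X f).
move=> Z cZ.
have ZE I : I != finset.set0 -> {ae P, forall w,
    (-1) ^+ #|I| * Z I w = hoeffding_kernel X f (subvect X I w)}.
  by move=> I0; apply: (Delta_condexp_kernel hX hX' hf sf); exact: cZ.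
split.
(* There are finitely many index sets, so one null set serves for all of them. *)
- have : {ae P, forall w, forall I, I != finset.set0 ->
      (-1) ^+ #|I| * Z I w = hoeffding_kernel X f (subvect X I w)}.
    apply: filter_forall => I; have [->|I0] := eqVneq I finset.set0.
      exact: aeW.
    by move: (ZE I I0); apply: filterS => w e _.
  have [_ _ _] := hk; apply: filterS2 => w -> e; congr (_ + _).
  (* The bound [1 <= k] is kept in the sum because it makes every set of cardinal [k] nonempty, as
     the identity for [Z I] requires. *)
  rewrite [LHS]big_nat_cond [RHS]big_nat_cond; apply: eq_bigr => k /andP[/andP[k0 _] _].
  apply: eq_bigr => I /eqP Ik; rewrite -Ik e// -card_gt0 Ik//.
- move=> phi hphi I I0.
  have := hoeffding_kernels_unique hX hX' hk hphi I0.
  by move: (ZE I I0); apply: filterS2 => w -> ->.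
- move=> I J I0 J0 IJ.
  have dI := hoeffding_kernels_degenerate hk I0.
  have dJ := hoeffding_kernels_degenerate hk J0.
  (* Almost surely [Z I * Z J] is [h] up to the constant sign [(-1) ^+ (#|I| + #|J|)], so
     integrability and orthogonality carry over from the kernels. *)
  pose h w := (hoeffding_kernel X f (subvect X I w) *
               hoeffding_kernel X f (subvect X J w)).
  have [_ sI _] := dI; have [_ sJ _] := dJ.
  have ih : P.-integrable [set: T] (fun w => ((-1) ^+ (#|I| + #|J|))%:E * (h w)%:E)%E.
    by apply: integrableZl => //; exact: square_integrableM.
  have eh : (\int[P]_w ((-1) ^+ (#|I| + #|J|) * h w)%:E = 0)%E.
    under eq_integral do rewrite EFinM.
    rewrite integralZl//; last exact: square_integrableM.
    by rewrite (degenerate_kernel_orthogonal hX hX')// mule0.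
  have mZ K : K != finset.set0 -> measurable_fun [set: T] (Z K).
    by move=> /cZ [_ iZ _ _]; apply/measurable_EFinP; exact: measurable_int iZ.
  have mZZ : measurable_fun [set: T] (fun w => (Z I w * Z J w)%:E).
    by apply/measurable_EFinP; apply: measurable_funM; exact: mZ.
  have aeZ : {ae P, forall w,
      ((-1) ^+ (#|I| + #|J|))%:E * (h w)%:E = (Z I w * Z J w)%:E}%E.
    move: (ZE I I0) (ZE J J0); apply: filterS2 => w eI eJ.
    rewrite /h -eI -eJ -EFinM; congr EFin.
    by rewrite [X in _ * X]mulrACA -exprD !mulrA -expr2 sqrr_sign mul1r.
  split; first exact: ae_eq_integrable mZZ aeZ ih.
  rewrite unlock -eh; apply/esym; apply: ae_eq_integral => //.
    exact: measurable_int ih.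
  by move: aeZ; apply: filterS => w e _; rewrite -e.
Qed.
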